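(* Let $K\subseteq\mathbb{R}^n$ be a convex polytope. (a) If $K$ has $m$ vertices with $m\geq n+1$, and $t=2^{n/(m-1)}$, then $$\Gamma_{2^n}(K)\leq\frac{m-1}{m-1+k(m-1,t)}\leq\frac{m-1}{m-1+\lfloor a(t)(m-1)\rfloor}.$$ (b) If $K$ is centrally symmetric and has $2m$ vertices with $m\geq n$, and $t=2^{n/m}$, then $$\Gamma_{2^n}(K)\leq\frac{m}{m+l(m,t)}\leq\frac{m}{m+\lfloor b(t)m\rfloor}.$$
   Context: For a compact convex set $K\subseteq\mathbb{R}^n$ and $N\in\mathbb{Z}^+$, the covering functional is $\Gamma_N(K)=\inf\{\gamma>0:\exists C\subseteq\mathbb{R}^n,\ |C|=N,\ K\subseteq C+\gamma K\}$. Let $f(x)=\frac{(1+x)^{1+x}}{x^x}$ and $g(x)=\frac{2^x(1+x)^{1+x}}{x^x}$ on $(0,\infty)$ (strictly increasing, tending to $1$ as $x\to0^+$); for $t>1$, $a(t)$ and $b(t)$ are the unique solutions of $f(x)=t$ and $g(x)=t$. For $t\in(1,2]$ and $d\in\mathbb{Z}^+$, $k(d,t)$ is the nonnegative integer with $\binom{d+k(d,t)}{d}\leq t^d<\binom{d+k(d,t)+1}{d}$, and $l(d,t)$ is the nonnegative integer with $2^{l(d,t)}\binom{d+l(d,t)}{d}\leq t^d<2^{l(d,t)+1}\binom{d+l(d,t)+1}{d}$. *)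

(* Defs.v *)
From HB Require Import structures.
From mathcomp Require Import all_boot all_order all_algebra.
From mathcomp Require Import all_classical all_reals.
From mathcomp Require Import exp.
Set Implicit Arguments. Unset Strict Implicit. Unset Printing Implicit Defensive.
Import Order.TTheory GRing.Theory Num.Theory.
Local Open Scope classical_set_scope.
Local Open Scope ring_scope.

Section Defs.
Variables (R : realType) (n : nat).
Local Notation V := 'rV[R]_n.

Definition conv (S : set V) : set V :=
  [set x | exists (k : nat) (w : 'I_k -> R) (p : 'I_k -> V),
      (forall i, 0 <= w i) /\ \sum_(i < k) w i = 1 /\
      (forall i, S (p i)) /\ x = \sum_(i < k) w i *: p i].

Definition is_polytope (K : set V) : Prop :=
  exists vs : seq V, K = conv [set` vs].

Definition is_extreme (K : set V) (x : V) : Prop :=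
  K x /\ forall y z (l : R), K y -> K z -> 0 < l -> l < 1 ->
     x = l *: y + (1 - l) *: z -> y = x /\ z = x.

Definition has_m_vertices (K : set V) (m : nat) : Prop :=
  exists vs : seq V, uniq vs /\ size vs = m /\
     [set x | is_extreme K x] = [set` vs].

Definition centrally_symmetric (K : set V) : Prop :=
  exists c : V, forall x, K x <-> K (2%:R *: c - x).

Definition Gamma (N : nat) (K : set V) : R :=
  inf [set g : R | 0 < g /\ exists C : seq V, uniq C /\ size C = N /\
        K `<=` [set z | exists c y, c \in C /\ K y /\ z = c + g *: y]].
End Defs.

Section Num.
Variable R : realType.

Definition ffun (x : R) : R := (1 + x) `^ (1 + x) / x `^ x.
Definition gfun (x : R) : R := 2 `^ x * (1 + x) `^ (1 + x) / x `^ x.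

(* a(t), b(t): the unique positive solutions of f(x)=t, g(x)=t *)
Definition afun (t : R) : R := xget 0 [set x | 0 < x /\ ffun x = t].
Definition bfun (t : R) : R := xget 0 [set x | 0 < x /\ gfun x = t].

Definition kfun (d : nat) (t : R) : nat :=
  xget 0%N [set k : nat | ('C(d + k, d))%:R <= t ^+ d /\
                          t ^+ d < ('C(d + k.+1, d))%:R].
Definition lfun (d : nat) (t : R) : nat :=
  xget 0%N [set l : nat | (2 ^ l * 'C(d + l, d))%:R <= t ^+ d /\
                          t ^+ d < (2 ^ l.+1 * 'C(d + l.+1, d))%:R].
End Num.

(* Main.v *)
Require Import Defs.
From HB Require Import structures.
From mathcomp Require Import all_boot all_order all_algebra.
From mathcomp Require Import all_classical all_reals.
From mathcomp Require Import exp.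
From mathcomp Require Import ring lra.
Import Order.TTheory GRing.Theory Num.Theory.
Local Open Scope classical_set_scope.
Local Open Scope ring_scope.

(* A polytope with d+1 vertices is an affine image of the d-simplex.  For
   barycentric coordinates w, the integer parts of (d+k) w_i have sum at least
   k, so they dominate some alpha in N^(d+1) with |alpha| = k; hence the
   C(d+k,d) homothetic copies of ratio d/(d+k) centred according to
   alpha/(d+k) cover the simplex.  A centrally symmetric polytope with 2m
   vertices is an affine image of the m-dimensional cross-polytope, which is
   covered in the same way by signed lattice points with |alpha| <= l, of which
   there are at most 2^l C(m+l,m).  The closed-form bounds come from bounding a
   single term of the binomial expansion of (1/(1+a) + a/(1+a))^(d+k) by 1. *)

(** * Convex hulls of finite families and their extreme points *)

Lemma conv_sum (R : realType) (n : nat) (S : set 'rV[R]_n) (J : finType)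
    (w : J -> R) (q : J -> 'rV[R]_n) :
  (forall j, 0 <= w j) -> \sum_j w j = 1 -> (forall j, S (q j)) ->
  conv S (\sum_j w j *: q j).
Proof.
move=> w0 w1 Sq; exists #|J|, (w \o enum_val), (q \o enum_val).
split=> [i|]; first exact: w0.
split; first by rewrite -w1 [RHS]big_enum_val.
by split=> [i|]; [exact: Sq | rewrite big_enum_val].
Qed.

(** Choosing an index for every point of a combination and adding up the weights that land on the
    same index turns a combination of arbitrary length into one over the fixed type [J]. *)
Lemma conv_weights (R : realType) (n : nat) (S : set 'rV[R]_n) (J : finType)
    (q : J -> 'rV[R]_n) (x : 'rV[R]_n) :
  S `<=` range q -> conv S x ->
  exists w : J -> R,
    [/\ forall j, 0 <= w j, \sum_j w j = 1 & x = \sum_j w j *: q j].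
Proof.
move=> Sq [k [w [p [w0 [w1 [Sp ->]]]]]].
have /choice[f fE] i : exists j, q j = p i by have [j _ ?] := Sq _ (Sp i); exists j.
exists (fun j => \sum_(i | f i == j) w i); split.
- by move=> j; apply: sumr_ge0.
- by rewrite -w1 [RHS](partition_big f xpredT).
- rewrite (partition_big f xpredT) //=; apply: eq_bigr => j _.
  by rewrite scaler_suml; apply: eq_bigr => i /eqP <-; rewrite fE.
Qed.

Lemma conv_conv (R : realType) (n : nat) (J : finType) (q : J -> 'rV[R]_n) :
  conv (conv (range q)) `<=` conv (range q).
Proof.
move=> x [k [w [p [w0 [w1 [Kp ->]]]]]].
have /choice[a aP] i := conv_weights R n _ J q (p i) (@subset_refl _ _) (Kp i).
rewrite (eq_bigr (fun i => \sum_j (w i * a i j) *: q j)); last first.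
  move=> i _; have [_ _ {1}->] := aP i; rewrite scaler_sumr.
  by apply: eq_bigr => j _; rewrite scalerA.
rewrite exchange_big /=; under eq_bigr do rewrite -scaler_suml.
apply: conv_sum => [j||j]; last by exists j.
- by apply: sumr_ge0 => i _; apply: mulr_ge0 => //; have [] := aP i.
- rewrite exchange_big /= -w1; apply: eq_bigr => i _.
  by rewrite -mulr_sumr; have [_ -> _] := aP i; rewrite mulr1.
Qed.

Lemma range_tnth (T : eqType) (s : seq T) :
  [set` s] = range (tnth (in_tuple s)).
Proof.
apply/seteqP; split=> [x /= /seq_tnthP[i ->]|_ [i _ <-] /=]; first by exists i.
exact: mem_tnth.
Qed.

(* An index set of minimal size carrying weights for every point of the hull
   consists of extreme points: a generator written as a nontrivial combination
   could be eliminated from all the representations. *)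
Lemma conv_range_extreme (R : realType) (n : nat) (J : finType)
    (q : J -> 'rV[R]_n) (x : 'rV[R]_n) :
  conv (range q) x -> conv [set y | is_extreme (conv (range q)) y] x.
Proof.
set K := conv (range q) => Kx.
pose P (A : {set J}) := `[< forall x, K x -> exists w : J -> R,
  [/\ forall j, 0 <= w j, forall j, j \notin A -> w j = 0,
      \sum_j w j = 1 & x = \sum_j w j *: q j] >].
have /ex_minset[A /minsetP[/asboolP PA Amin]] : exists A, P A.
  exists [set: J]%SET; apply/asboolP => y /(conv_weights _ _ _ J q _ (@subset_refl _ _)).
  by case=> w [w0 w1 yE]; exists w; split=> // j; rewrite inE.
have Kq j : K (q j).
  rewrite [X in K X](_ : _ = \sum_i (i == j)%:R *: q i).
    apply: conv_sum => [i||i]; [by rewrite ler0n| |by exists i].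
    by rewrite (bigD1 j)//= eqxx big1 ?addr0// => i /negPf->.
  rewrite (bigD1 j)//= eqxx scale1r big1 ?addr0// => i /negPf->.
  by rewrite scale0r.
have Aext j : j \in A -> is_extreme K (q j).
  move=> jA; split=> // y z l Ky Kz l0 l1 qE.
  have [a [a0 aA a1 yE]] := PA _ Ky; have [b [b0 bA b1 zE]] := PA _ Kz.
  have degen (c : J -> R) : (forall i, 0 <= c i) -> \sum_i c i = 1 -> c j = 1 ->
      \sum_i c i *: q i = q j.
    move=> c0; rewrite (bigD1 j)//= => c1 cj.
    have /eqP : \sum_(i | i != j) c i = 0 by lra.
    rewrite psumr_eq0// => /allP cz.
    rewrite (bigD1 j)//= cj scale1r big1 ?addr0// => i ij.
    by have := cz i (mem_index_enum i); rewrite ij => /eqP ->; rewrite scale0r.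
  have le1 (c : J -> R) : (forall i, 0 <= c i) -> \sum_i c i = 1 -> c j <= 1.
    move=> c0 <-; rewrite (bigD1 j)//= lerDl; exact: sumr_ge0.
  (* Mixing the weights of [y] and [z] expresses [q j] through the whole family, itself included.
     Either its own coefficient is 1, and then [y] and [z] coincide with [q j], or the relation can
     be solved for [q j]. *)
  pose p i := l * a i + (1 - l) * b i.
  have p0 i : 0 <= p i by rewrite addr_ge0// mulr_ge0// ?subr_ge0 ltW.
  have p1 : \sum_i p i = 1.
    by rewrite big_split/= -!mulr_sumr a1 b1; lra.
  have qp : q j = \sum_i p i *: q i.
    rewrite qE yE zE !scaler_sumr -big_split/=; apply: eq_bigr => i _.
    by rewrite !scalerA -scalerDl.
  have [pj|pj] := eqVneq (p j) 1.
    have aj := le1 _ a0 a1; have bj := le1 _ b0 b1.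
    (* These two nonnegative quantities add up to [1 - p j], which is 0, so both vanish. *)
    have l1a : l * (1 - a j) >= 0 by rewrite mulr_ge0 ?subr_ge0// ltW.
    have l1b : (1 - l) * (1 - b j) >= 0 by rewrite mulr_ge0 ?subr_ge0// ltW.
    have l1a0 : l * (1 - a j) = 0 by rewrite /p in pj; lra.
    have l1b0 : (1 - l) * (1 - b j) = 0 by rewrite /p in pj; lra.
    split; rewrite ?yE ?zE; apply: degen => //.
      by move/eqP: l1a0; rewrite mulf_eq0 => /orP[]/eqP; lra.
    by move/eqP: l1b0; rewrite mulf_eq0 => /orP[]/eqP; lra.
  have pjlt : 0 < 1 - p j by have := le1 _ p0 p1; rewrite le_eqVlt (negPf pj)/=; lra.
  have qj : q j = \sum_(i | i != j) (p i / (1 - p j)) *: q i.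
    apply: (scalerI (lt0r_neq0 pjlt)).
    rewrite scaler_sumr scalerBl scale1r {1}qp (bigD1 j)//= [LHS]addrC addKr.
    apply: eq_bigr => i _; rewrite scalerA; congr (_ *: _).
    by rewrite mulrC divfK// lt0r_neq0.
  have /Amin/(_ (subsetDl _ _)) AE : P (A :\ j)%SET.
    apply/asboolP => u Ku; have [w [w0 wA w1 uE]] := PA _ Ku.
    (* The weight of [j] is passed on to the other indices in proportion to [p]. *)
    exists (fun i => if i == j then 0 else w i + w j * (p i / (1 - p j))); split.
    - move=> i; case: eqP => // _; rewrite addr_ge0// mulr_ge0// divr_ge0//.
      exact: ltW.
    - move=> i; rewrite !inE; case: eqP => //= _ iA.
      by rewrite /p aA// bA// wA// !mulr0 addr0 mul0r mulr0 addr0.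
    - rewrite (bigD1 j)//= eqxx add0r.
      rewrite (eq_bigr (fun i => w i + w j * (p i / (1 - p j)))); last first.
        by move=> i /negPf ->.
      rewrite big_split/= -mulr_sumr -mulr_suml.
      have -> : \sum_(i | i != j) p i = 1 - p j.
        by rewrite -p1 [in RHS](bigD1 j)//= [RHS]addrC addKr.
      by rewrite divff ?lt0r_neq0// mulr1 addrC -w1 [RHS](bigD1 j).
    - rewrite uE (bigD1 j)//= qj scaler_sumr -big_split/=.
      rewrite [RHS](bigD1 j)//= eqxx scale0r add0r.
      apply: eq_bigr => i /negPf ->.
      by rewrite scalerA addrC -scalerDl.
  by have := jA; rewrite -AE !inE eqxx.
have [w [w0 wA w1 xE]] := PA _ Kx.
have -> : x = \sum_(j : {x in A}) w (val j) *: q (val j).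
  rewrite xE (bigID [in A])/= [X in _ + X]big1 ?addr0; last first.
    by move=> j /wA ->; rewrite scale0r.
  by rewrite big_sub.
apply: conv_sum => [j||[j jA]]; [exact: w0| |exact: Aext].
rewrite -w1 [RHS](bigID [in A])/= [X in _ = _ + X]big1 ?addr0; last first.
  by move=> j /wA ->.
by rewrite [RHS]big_sub.
Qed.

Lemma sub_conv (R : realType) (n : nat) (S T : set 'rV[R]_n) :
  S `<=` T -> conv S `<=` conv T.
Proof.
move=> ST x [k [w [p [w0 [w1 [Sp ->]]]]]].
by exists k, w, p; do !split=> //; move=> i; apply/ST/Sp.
Qed.

(** Minkowski's theorem for polytopes. It turns a count of vertices into a count of generators. *)
Lemma polytope_conv_extreme (R : realType) (n : nat) (K : set 'rV[R]_n) :
  is_polytope K -> K = conv [set x | is_extreme K x].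
Proof.
move=> [s ->]; rewrite range_tnth; apply/seteqP; split=> x.
  exact: conv_range_extreme.
move=> Kx; apply: conv_conv; apply: sub_conv Kx => y [] //.
Qed.

(** * Integer truncation and weighted binomial coefficients *)

Lemma truncate_sum (n : nat) (b : 'I_n -> nat) (k : nat) :
  (k <= \sum_i b i)%N ->
  exists a : 'I_n -> nat, (forall i, (a i <= b i)%N) /\ (\sum_i a i)%N = k.
Proof.
elim: k => [_|k IH kb].
  by exists (fun=> 0%N); rewrite big1_eq.
have [a [ab ak]] := IH (ltnW kb).
have [i ai] : exists i, (a i < b i)%N.
  case: (pickP (fun i => a i < b i)%N) => [i ?|ba]; first by exists i.
  move: kb; rewrite ltnNge -ak leq_sum// => i _.
  by rewrite leqNgt ba.
exists (fun j => (a j + (j == i))%N); split=> [j|].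
  by case: eqP => [->|_]; rewrite ?addn1 ?addn0.
by rewrite big_split/= ak (bigD1 i)//= eqxx big1 ?addn0 ?addn1// => j /negPf->.
Qed.

(** The weight [c] treats both parts at once: [c = 1] gives the numbers defining k(d,t), and [c = 2]
    those defining l(d,t). *)
Lemma monotone_bin_weighted (c d : nat) : (0 < c)%N ->
  {homo (fun k => c ^ k * 'C(d + k, d))%N : i j / (i <= j)%N}.
Proof.
move=> c0 i j ij; apply: leq_mul; first by rewrite leq_pexp2l.
by apply: leq_bin2l; rewrite leq_add2l.
Qed.

(** This bounds the indices whose weighted binomial stays below a given number, so that a largest
    one exists. *)
Lemma leq_bin_weighted (c d k : nat) : (0 < c)%N -> (0 < d)%N ->
  (k < c ^ k * 'C(d + k, d))%N.
Proof.
case: d => // d c0 _; apply: (@leq_trans 'C(d.+1 + k, d.+1)); last first.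
  by rewrite leq_pmull// expn_gt0 c0.
elim: k => [|k IH]; first by rewrite addn0 binn.
rewrite addnS binS -addn1 leq_add// bin_gt0.
by rewrite addSn -addnS leq_addr.
Qed.

(* The term of index k in (1/(1+a) + a/(1+a))^(d+k) = 1 is at most 1. *)
Lemma bin_le_entropy (R : realType) (a : R) (d k : nat) :
  0 < a -> 'C(d + k, d)%:R * a ^+ k <= (1 + a) ^+ (d + k).
Proof.
move=> a0; rewrite exprDn.
have kd : (k < (d + k).+1)%N by rewrite ltnS leq_addl.
rewrite (bigD1 (Ordinal kd))//= addnK expr1n mul1r.
rewrite -bin_sub ?leq_addr// addKn mulr_natl lerDl.
by apply: sumr_ge0 => i _; rewrite mulrn_wge0// mulr_ge0 ?exprn_ge0 ?ler01// ltW.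
Qed.

(** Put r = c(1+a)/a, so that r >= 1 and the equation reads t = (1+a) r^a. The single-term bound
    gives c^k C(d+k,d) <= (1+a)^d r^k, and k <= ad then gives r^k <= r^(ad). *)
Lemma bin_floor_le (R : realType) (a : R) (c d : nat) (t : R) :
  (0 < c)%N -> 0 < a ->
  c%:R `^ a * (1 + a) `^ (1 + a) / a `^ a = t ->
  (c ^ Num.truncn (a * d%:R) * 'C(d + Num.truncn (a * d%:R), d))%:R <= t ^+ d.
Proof.
move=> c0 a0 <-; set k := Num.truncn _.
have ad0 : 0 <= a * d%:R by rewrite mulr_ge0// ltW.
have kad : k%:R <= a * d%:R by rewrite truncn_le.
have a10 : 0 < 1 + a by rewrite addr_gt0.
pose r := c%:R * (1 + a) / a.
have c1 : 1 <= c%:R :> R by rewrite ler1n.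
have r1 : 1 <= r.
  by rewrite /r ler_pdivlMr// mul1r (le_trans (y := 1 + a)) ?ler_peMl ?lerDr// ltW.
apply: (@le_trans _ _ ((1 + a) ^+ d * r ^+ k)).
  rewrite natrM natrX /r expr_div_n exprMn !mulrA ler_pdivlMr ?exprn_gt0//.
  rewrite [leRHS]mulrAC -exprD -mulrA mulrC.
  by rewrite ler_wpM2r ?exprn_ge0 ?ler0n// bin_le_entropy.
have -> : c%:R `^ a * (1 + a) `^ (1 + a) / a `^ a = (1 + a) * r `^ a.
  rewrite powRD; last by rewrite gt_eqF ?implybT.
  rewrite powRr1 ?ltW// /r !powRM ?mulr_ge0 ?invr_ge0 ?ler0n ?ltW//.
  rewrite -(powR_inv1 (ltW a0)) -powRrM mulN1r powRN; ring.
rewrite [leRHS]exprMn; apply: ler_wpM2l; first by rewrite exprn_ge0// ltW.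
rewrite -powR_mulrn ?(le_trans ler01)// -[leRHS]powR_mulrn ?powR_ge0//.
by rewrite -powRrM ler_powR.
Qed.

(** * Covering affine images of the simplex *)

Lemma extend_uniq (T : eqType) (f : nat -> T) (s : seq T) (N : nat) :
  injective f -> uniq s -> (size s <= N)%N ->
  exists C, [/\ uniq C, size C = N & {subset s <= C}].
Proof.
move=> injf us; elim: N => [|N IH]; rewrite leq_eqVlt => /predU1P[sN|] //.
- by exists s; split.
- by exists s; split.
rewrite ltnS => /IH[C [uC sC subC]].
(* Pigeonhole: [N.+1] distinct values of [f] do not fit into a list of length [N]. *)
have [i fi] : exists i, f i \notin C.
  apply/not_existsP => fC.
  have /uniq_leq_size : uniq (map f (iota 0 N.+1)).
    by rewrite map_inj_uniq// iota_uniq.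
  move=> /(_ C); rewrite size_map size_iota sC ltnn; apply/not_implyP; split=> //.
  by move=> _ /mapP[i _ ->]; apply/negPn/negP/fC.
exists (f i :: C); split=> /=; [by rewrite fi|by rewrite sC|].
by move=> x /subC; rewrite inE orbC => ->.
Qed.

(** The functional asks for exactly [N] distinct centres. Repetitions are removed and the list is
    padded with constant vectors, which are pairwise distinct because [0 < n]. *)
Lemma Gamma_le (R : realType) (n : nat) (K : set 'rV[R]_n) (N : nat) (g : R)
    (s : seq 'rV[R]_n) :
  (0 < n)%N -> 0 < g -> (size s <= N)%N ->
  (forall x, K x -> exists c y, c \in s /\ K y /\ x = c + g *: y) ->
  Gamma N K <= g.
Proof.
case: n K s => // n K s _ g0 sN cov.
pose f (i : nat) : 'rV[R]_n.+1 := const_mx i%:R.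
have injf : injective f.
  move=> i j /matrixP/(_ ord0 ord0); rewrite !mxE => /eqP.
  by rewrite eqr_nat => /eqP.
have sN' := leq_trans (size_undup s) sN.
have [C [uC sC subC]] := extend_uniq _ f _ N injf (undup_uniq s) sN'.
apply: ge_inf; first by exists 0 => y [/ltW].
split=> //; exists C; split=> //; split=> // x Kx.
have [c [y [cs [Ky ->]]]] := cov x Kx.
by exists c, y; rewrite subC// mem_undup.
Qed.

Lemma leq_sum_term (n : nat) (a : 'I_n -> nat) (i : 'I_n) :
  (a i <= \sum_j a j)%N.
Proof. by rewrite (bigD1 i)//= leq_addr. Qed.

(** All work is done on barycentric weights, so the covering of the simplex is transported to the
    hull of any [d.+1] points. *)
Lemma Gamma_simplex_image (R : realType) (n d k N : nat)
    (v : 'I_d.+1 -> 'rV[R]_n) :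
  (0 < n)%N -> (0 < d)%N -> ('C(d + k, d) <= N)%N ->
  Gamma N (conv (range v)) <= d%:R / (d%:R + k%:R).
Proof.
move=> n0 d0 CN.
have dR0 : 0 < d%:R :> R by rewrite ltr0n.
have dkR0 : 0 < d%:R + k%:R :> R by rewrite ltr_wpDr.
pose center (t : d.+1.-tuple 'I_k.+1) :=
  \sum_i ((tnth t i)%:R / (d%:R + k%:R)) *: v i.
pose A := [set t : d.+1.-tuple 'I_k.+1 | (\sum_(i <- t) i)%N == k]%SET.
apply: (@Gamma_le _ _ _ _ _ [seq center t | t <- enum A]) => //.
- exact: divr_gt0.
- by rewrite size_map -cardE card_ord_partitions.
move=> x /(conv_weights _ _ _ _ v _ (@subset_refl _ _))[w [w0 w1 ->]].
pose b i := Num.truncn ((d%:R + k%:R) * w i).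
have bw i : (b i)%:R <= (d%:R + k%:R) * w i < (b i).+1%:R.
  by apply: truncn_itv; rewrite mulr_ge0// ltW.
have /truncate_sum[a [ab ak]] : (k <= \sum_i b i)%N.
  (* The scaled weights sum to d+k, and each of the d+1 truncations loses strictly less than 1.
     Hence the integer parts sum to more than k-1. *)
  rewrite -ltnS -(ltn_add2l d) -addSnnS -(ltr_nat R).
  have -> : (d + k)%:R = \sum_i (d%:R + k%:R) * w i.
    by rewrite -mulr_sumr w1 mulr1 natrD.
  have -> : (d.+1 + \sum_i b i)%:R = \sum_(i < d.+1) (b i).+1%:R :> R.
    rewrite -natr_sum; congr (_%:R); under [RHS]eq_bigr do rewrite -add1n.
    by rewrite big_split/= sum1_card card_ord.
  apply: ltr_sum => [|i _]; last by have /andP[] := bw i.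
  by apply/hasP; exists ord0; rewrite ?mem_index_enum.
have aik i : (a i < k.+1)%N by rewrite ltnS -ak leq_sum_term.
pose t := [tuple inord (a i) : 'I_k.+1 | i < d.+1].
have tE i : tnth t i = a i :> nat by rewrite tnth_mktuple inordK.
(* The residual weights are nonnegative as [a i <= b i], and sum to ((d+k) - k)/d = 1. *)
exists (center t), (\sum_i (((d%:R + k%:R) * w i - (a i)%:R) / d%:R) *: v i).
split; [|split].
- apply: map_f; rewrite mem_enum inE big_tuple; apply/eqP.
  by rewrite -[RHS]ak; apply: eq_bigr => i _; rewrite tE.
- apply: conv_sum => [i||i]; last by exists i.
    rewrite divr_ge0 ?ler0n// subr_ge0; have /andP[+ _] := bw i.
    by apply: le_trans; rewrite ler_nat.
  rewrite -mulr_suml sumrB -mulr_sumr w1 -natr_sum ak mulr1 addrK divff//.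
  by rewrite gt_eqF.
- rewrite scaler_sumr -big_split/=; apply: eq_bigr => i _.
  rewrite scalerA -scalerDl tE; congr (_ *: _).
  by field; rewrite !gt_eqF.
Qed.

(** * Covering affine images of the cross-polytope *)

Lemma sum_pair_bool (V : nmodType) (I : finType) (F : I * bool -> V) :
  \sum_p F p = \sum_i (F (i, true) + F (i, false)).
Proof.
rewrite (eq_bigr (fun p => F (p.1, p.2))); last by case.
rewrite -(pair_bigA _ (fun i b => F (i, b)))/=.
by apply: eq_bigr => i _; rewrite big_bool.
Qed.

Section CrossPolytope.
Variables (R : realType) (n m : nat) (c : 'rV[R]_n) (u : 'I_m -> 'rV[R]_n).

Let q (p : 'I_m * bool) := c + (-1) ^+ p.2 *: u p.1.

Lemma conv_cross_coord (x : 'rV[R]_n) : conv (range q) x ->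
  exists y : 'I_m -> R, \sum_i `|y i| <= 1 /\ x = c + \sum_i y i *: u i.
Proof.
move=> /(conv_weights _ _ _ _ q _ (@subset_refl _ _))[w [w0 w1 ->]].
(* A coordinate is the difference of the weights of two opposite vertices. *)
exists (fun i => w (i, false) - w (i, true)); split.
  rewrite -w1 sum_pair_bool; apply: ler_sum => i _.
  rewrite addrC; apply: le_trans (ler_normB _ _) _.
  by rewrite !ger0_norm.
under eq_bigr do rewrite scalerDr.
rewrite big_split/= -scaler_suml w1 scale1r; congr (_ + _).
rewrite sum_pair_bool.
apply: eq_bigr => i _; rewrite /= expr0 expr1 scale1r scaleN1r.
by rewrite scalerN scalerBl addrC.
Qed.

Lemma conv_cross_mem (y : 'I_m -> R) : (0 < m)%N -> \sum_i `|y i| <= 1 ->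
  conv (range q) (c + \sum_i y i *: u i).
Proof.
(* The slack in the norm bound is shared equally among the [m] antipodal pairs. The two weights of
   pair [i] have sum |y_i| + e and difference y_i. *)
move=> m0 y1; pose e := (1 - \sum_i `|y i|) / m%:R.
have mR0 : m%:R != 0 :> R by rewrite pnatr_eq0 -lt0n.
pose w (p : 'I_m * bool) := (`|y p.1| + (-1) ^+ p.2 * y p.1 + e) / 2.
have w1 : \sum_p w p = 1.
  rewrite sum_pair_bool /w.
  rewrite (eq_bigr (fun i => `|y i| + e)); last first.
    by move=> i _; rewrite /= expr0 expr1; field.
  rewrite big_split/= sumr_const card_ord -[e *+ m]mulr_natr divfK//.
  by rewrite addrC subrK.
rewrite (_ : c + _ = \sum_p w p *: q p).
  apply: conv_sum => [[i b]||p]; [|exact: w1|by exists p].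
  rewrite divr_ge0// addr_ge0//; last by rewrite divr_ge0 ?subr_ge0.
  rewrite -[leLHS](subrr `|y i|) lerD2l lerNl.
  by rewrite (le_trans (ler_norm _))// normrN normrM normrX normrN1 expr1n mul1r.
under [RHS]eq_bigr do rewrite scalerDr.
rewrite big_split/= -scaler_suml w1 scale1r; congr (_ + _).
rewrite sum_pair_bool.
apply: eq_bigr => i _; rewrite /= !scalerA -scalerDl /w/= expr0 expr1.
by congr (_ *: _); field.
Qed.

Lemma Gamma_cross_image (l N : nat) :
  (0 < n)%N -> (0 < m)%N -> (2 ^ l * 'C(m + l, m) <= N)%N ->
  Gamma N (conv (range q)) <= m%:R / (m%:R + l%:R).
Proof.
move=> n0 m0 CN.
have mR0 : 0 < m%:R :> R by rewrite ltr0n.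
have mlR0 : 0 < m%:R + l%:R :> R by rewrite ltr_wpDr.
set g := _ / _.
(* A centre is given by absolute values [t] and a set [B] of negative coordinates. Taking [B] inside
   the support avoids counting signs of zero entries. *)
pose supp (t : m.-tuple 'I_l.+1) := [set i | tnth t i != 0%N :> nat]%SET.
pose center (t : m.-tuple 'I_l.+1) (B : {set 'I_m}) := (1 - g) *: c +
  \sum_i ((-1) ^+ (i \in B) * (tnth t i)%:R / (m%:R + l%:R)) *: u i.
pose A := [set t : m.-tuple 'I_l.+1 | (\sum_(i <- t) i <= l)%N]%SET.
apply: (@Gamma_le _ _ _ _ _
  [seq center t B | t <- enum A, B <- enum (powerset (supp t))]) => //.
- exact: divr_gt0.
(* There are C(m+l,m) tuples of sum at most l. Each has a support of size at most l, hence at most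
   2^l sign choices. *)
- apply: leq_trans CN; rewrite size_allpairs_dep sumnE big_map.
  rewrite -card_partial_ord_partitions mulnC -sum_nat_const big_enum/=.
  apply: leq_sum => t; rewrite inE big_tuple => tl.
  rewrite -cardE card_powerset leq_exp2l// (leq_trans _ tl)//.
  rewrite -sum1_card big_mkcond/=; apply: leq_sum => i _.
  by rewrite inE; case: eqP => // /eqP; rewrite lt0n.
move=> x /conv_cross_coord[z [z1 ->]].
pose b i := Num.truncn ((m%:R + l%:R) * `|z i|).
have bz i : (b i)%:R <= (m%:R + l%:R) * `|z i| < (b i).+1%:R.
  by apply: truncn_itv; rewrite mulr_ge0// ltW.
have [a [ab ak]] := truncate_sum _ b _ (geq_minr l (\sum_i b i)).
have al : (\sum_i a i <= l)%N by rewrite ak geq_minl.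
have azi i : (a i)%:R <= (m%:R + l%:R) * `|z i|.
  by have /andP[+ _] := bz i; apply: le_trans; rewrite ler_nat.
have az : \sum_i ((m%:R + l%:R) * `|z i| - (a i)%:R) <= m%:R.
  (* If the integer parts reach l, the residuals sum to at most (m+l) - l. Otherwise nothing is
     truncated further, and each of the m residuals is below 1. *)
  have [lb|bl] := leqP l (\sum_i b i)%N.
    rewrite sumrB -mulr_sumr -natr_sum ak (minn_idPl lb) lerBlDr.
    by rewrite ler_piMr// ltW.
  have aE i : a i = b i.
    apply/eqP; rewrite eqn_leq ab leqNgt; apply/negP => abi.
    have : (\sum_i a i < \sum_i b i)%N.
      by rewrite (bigD1 i)//= [X in (_ < X)%N](bigD1 i)//= -addSn leq_add// leq_sum.
    by rewrite ak (minn_idPr (ltnW bl)) ltnn.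
  rewrite -[m in leRHS]card_ord -sum1_card natr_sum; apply: ler_sum => i _.
  by have /andP[_] := bz i; rewrite aE -natr1; lra.
have ail i : (a i < l.+1)%N by rewrite ltnS (leq_trans _ al)// leq_sum_term.
pose t := [tuple inord (a i) : 'I_l.+1 | i < m].
have tE i : tnth t i = a i :> nat by rewrite tnth_mktuple inordK.
pose B := [set i in supp t | z i < 0]%SET.
pose s i : R := (-1) ^+ (i \in B).
exists (center t B),
  (c + \sum_i (((m%:R + l%:R) * z i - s i * (a i)%:R) / m%:R) *: u i).
split; [|split].
- apply/allpairsPdep; exists t, B; rewrite !mem_enum !inE; split=> //.
    by rewrite big_tuple (eq_bigr a)// => i _; rewrite tE.
  by apply/fintype.subsetP => i; rewrite inE => /andP[].
- apply: conv_cross_mem => //.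
  rewrite (eq_bigr (fun i => ((m%:R + l%:R) * `|z i| - (a i)%:R) / m%:R)).
    by rewrite -mulr_suml ler_pdivrMr ?mul1r.
  (* The sign matches that of [z i], so subtracting [a i], which is at most (m+l)|z_i|, only
     shortens the coordinate. *)
  move=> i _; rewrite normrM normfV (gtr0_norm mR0); congr (_ / _).
  have := azi i; rewrite /s !inE tE; have [->|ai0] := eqVneq (a i) 0%N.
    by rewrite mulr0 !subr0 normrM gtr0_norm.
  rewrite /=; case: ltP => zi; rewrite ?expr0 ?expr1.
    by rewrite ltr0_norm// => azi'; rewrite ler0_norm; lra.
  by rewrite ger0_norm// => azi'; rewrite ger0_norm; lra.
- rewrite /center scalerDr addrACA -scalerDl subrK scale1r; congr (_ + _).
  rewrite scaler_sumr -big_split/=; apply: eq_bigr => i _.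
  rewrite scalerA -scalerDl tE -/(s i); congr (_ *: _).
  by rewrite /g; field; rewrite !gt_eqF.
Qed.
End CrossPolytope.

(** * Central symmetry and antipodal pairs of vertices *)

Lemma involution_transversal (T : eqType) (f : T -> T) (s : seq T) (m : nat) :
  uniq s -> size s = (2 * m)%N -> involutive f ->
  {in s, forall x, f x \in s} -> {in s, forall x, f x != x} ->
  exists2 r, size r = m & [set` s] = [set` r] `|` f @` [set` r].
Proof.
move=> us sm ff fs fx.
(* From each orbit the element occurring first in [s] is kept; [f] swaps kept and discarded
   elements, so exactly half remain. *)
pose P x := (index x s < index (f x) s)%N.
have PfN : {in s, forall x, P (f x) = ~~ P x}.
  move=> x xs; rewrite /P ff -leqNgt [RHS]leq_eqVlt.
  case: eqP => //= /(congr1 (nth x s)); rewrite !nth_index ?fs// => xf.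
  by have := fx _ xs; rewrite xf eqxx.
have perm_f : perm_eq s (map f s).
  have ufs : uniq (map f s) by rewrite map_inj_uniq//; exact: inv_inj.
  apply: uniq_perm => // x; apply/idP/mapP => [xs|[y ys ->]]; last exact: fs.
  by exists (f x); rewrite ?fs ?ff.
exists [seq x <- s | P x].
  have : (2 * count P s = 2 * m)%N.
    rewrite mul2n -addnn {2}(permP perm_f P) count_map -sm -(count_predC P s).
    by congr addn; apply: eq_in_count => x /= /PfN.
  by move/eqP; rewrite size_filter eqn_pmul2l// => /eqP.
apply/seteqP; split=> [x /= xs|x /=].
  have [Px|/negPf Px] := boolP (P x); first by left; rewrite mem_filter Px.
  right; exists (f x); last exact: ff.
  by rewrite /= mem_filter PfN// Px fs.
case=> [|[y /= + <-]]; rewrite mem_filter => /andP[_]; [by []|exact: fs].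
Qed.

Lemma is_extreme_reflect (R : realType) (n : nat) (K : set 'rV[R]_n) (c x : 'rV[R]_n) :
  (forall x, K x <-> K (2%:R *: c - x)) ->
  is_extreme K x -> is_extreme K (2%:R *: c - x).
Proof.
move=> sym [Kx ext]; split; first by rewrite -sym.
move=> y z l Ky Kz l0 l1 xE.
have [] := ext (2%:R *: c - y) (2%:R *: c - z) l _ _ l0 l1; rewrite -?sym//.
  rewrite !scalerBr addrACA -scalerDl [l + _]addrC subrK scale1r -opprD -xE.
  by rewrite subKr.
by move=> yE zE; split; [rewrite -yE|rewrite -zE]; rewrite subKr.
Qed.

(** The centre is the midpoint of [x] and its reflection. This will rule out the centre as a vertex
    when there are at least two vertices. *)
Lemma extreme_center (R : realType) (n : nat) (K : set 'rV[R]_n) (c x : 'rV[R]_n) :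
  (forall x, K x <-> K (2%:R *: c - x)) -> is_extreme K c -> K x -> x = c.
Proof.
move=> sym [_ ext] Kx.
have Kx' : K (2%:R *: c - x) by rewrite -sym.
have [] // := ext x _ 2^-1 Kx Kx'; [by lra|by lra|].
rewrite [1 - _](_ : _ = 2^-1 :> R); last by field.
by rewrite -scalerDr addrC subrK scalerA mulVf ?scale1r// pnatr_eq0.
Qed.

(** * Maximal indices and the closed-form bounds *)

Lemma powR_div_exprn (R : realType) (n d : nat) : (0 < d)%N ->
  ((2 : R) `^ (n%:R / d%:R)) ^+ d = (2 ^ n)%:R.
Proof.
move=> d0; rewrite -powR_mulrn ?powR_ge0// -powRrM divfK ?pnatr_eq0 -?lt0n//.
by rewrite powR_mulrn// natrX.
Qed.

(** Index 0 is admissible since [N] is positive, and admissible indices are bounded. The largest one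
    satisfies both inequalities, so [xget] returns a genuine solution, and monotonicity makes that
    solution maximal. *)
Lemma weighted_index_spec (R : realType) (c d N : nat) (t : R) :
  (0 < c)%N -> (0 < d)%N -> (0 < N)%N -> t ^+ d = N%:R ->
  let k := xget 0%N [set k : nat | (c ^ k * 'C(d + k, d))%:R <= t ^+ d /\
                          t ^+ d < (c ^ k.+1 * 'C(d + k.+1, d))%:R] in
  (c ^ k * 'C(d + k, d) <= N)%N /\
  (forall j, (c ^ j * 'C(d + j, d))%:R <= t ^+ d -> (j <= k)%N).
Proof.
move=> c0 d0 N0 tN k.
have [kN Nk] : (c ^ k * 'C(d + k, d))%:R <= t ^+ d /\
               t ^+ d < (c ^ k.+1 * 'C(d + k.+1, d))%:R.
  apply: (@xgetPex _ 0%N [set k : nat | (c ^ k * 'C(d + k, d))%:R <= t ^+ d /\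
                          t ^+ d < (c ^ k.+1 * 'C(d + k.+1, d))%:R]).
  have ex0 : exists j, (c ^ j * 'C(d + j, d) <= N)%N.
    by exists 0%N; rewrite addn0 binn expn0.
  have bnd j : (c ^ j * 'C(d + j, d) <= N)%N -> (j <= N)%N.
    by apply: leq_trans; rewrite ltnW// leq_bin_weighted.
  case: (ex_maxnP ex0 bnd) => j jN jmax; exists j => /=.
  rewrite tN ler_nat ltr_nat jN; split=> //; rewrite ltnNge.
  by apply/negP => /jmax; rewrite ltnn.
split; first by move: kN; rewrite tN ler_nat.
move=> j jt; rewrite leqNgt; apply/negP => kj.
have := le_lt_trans jt Nk; rewrite ltr_nat ltnNge => /negP; apply.
exact: monotone_bin_weighted.
Qed.

Lemma ratio_antitone (R : realType) (d i j : nat) : (0 < d)%N -> (i <= j)%N ->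
  d%:R / (d%:R + j%:R) <= d%:R / (d%:R + i%:R) :> R.
Proof.
move=> d0 ij; have dR0 : 0 < d%:R :> R by rewrite ltr0n.
by rewrite ler_pM2l// lef_pV2 ?posrE ?ltr_wpDr// lerD2l ler_nat.
Qed.

(** The floor of [a * d] is itself an admissible index, so maximality of [k] compares the two
    ratios. *)
Lemma ratio_floor_le (R : realType) (c d k : nat) (a t : R) :
  (0 < c)%N -> (0 < d)%N ->
  a = xget 0 [set x : R | 0 < x /\
    c%:R `^ x * (1 + x) `^ (1 + x) / x `^ x = t] ->
  (forall j, (c ^ j * 'C(d + j, d))%:R <= t ^+ d -> (j <= k)%N) ->
  d%:R / (d%:R + k%:R) <= d%:R / (d%:R + (Num.floor (a * d%:R))%:~R) :> R.
Proof.
move=> c0 d0 aE kmax.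
(* When the equation has no solution, [xget] returns 0 and the bound is 1. *)
have [a0 ak] : 0 <= a /\ (Num.truncn (a * d%:R) <= k)%N.
  rewrite aE; case: xgetP => [x _ [x0 xt]|_]; last by rewrite mul0r truncn0.
  by split; [exact: ltW|apply: kmax; exact: bin_floor_le].
have -> : (Num.floor (a * d%:R))%:~R = (Num.truncn (a * d%:R))%:R :> R.
  rewrite truncn_floor mulr_ge0//.
  by rewrite [RHS]pmulrn gez0_abs// floor_ge0 mulr_ge0.
exact: ratio_antitone.
Qed.

(** * Application to the vertex sets of polytopes *)

Theorem theorem4p3 (R : realType) (n : nat) (K : set 'rV[R]_n) :
  (0 < n)%N -> is_polytope K ->
  (forall m : nat, (n + 1 <= m)%N -> has_m_vertices K m ->
     let t : R := 2 `^ (n%:R / (m.-1)%:R) in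
     Gamma (2 ^ n)%N K <= (m.-1)%:R / ((m.-1)%:R + (kfun m.-1 t)%:R) /\
     (m.-1)%:R / ((m.-1)%:R + (kfun m.-1 t)%:R)
       <= ((m.-1)%:R / ((m.-1)%:R + (Num.floor (afun t * (m.-1)%:R))%:~R) : R)) /\
  (centrally_symmetric K ->
   forall m : nat, (n <= m)%N -> has_m_vertices K (2 * m) ->
     let t : R := 2 `^ (n%:R / m%:R) in
     Gamma (2 ^ n)%N K <= m%:R / (m%:R + (lfun m t)%:R) /\
     m%:R / (m%:R + (lfun m t)%:R)
       <= (m%:R / (m%:R + (Num.floor (bfun t * m%:R))%:~R) : R)).
Proof.
move=> n0 /polytope_conv_extreme KE; split.
  move=> m nm [vs [_ [sm vsE]]] t.
  have m1 : (1 < m)%N by rewrite (leq_trans _ nm)// addn1 ltnS.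
  have d0 : (0 < m.-1)%N by rewrite -ltnS prednK// ltnW.
  have tE : t ^+ m.-1 = (2 ^ n)%:R by apply: powR_div_exprn.
  have N0 : (0 < 2 ^ n)%N by rewrite expn_gt0.
  have [kN kmax] := weighted_index_spec R 1 _ _ t isT d0 N0 tE.
  have kE : kfun m.-1 t = xget 0%N
      [set k : nat | (1 ^ k * 'C(m.-1 + k, m.-1))%:R <= t ^+ m.-1 /\
         t ^+ m.-1 < (1 ^ k.+1 * 'C(m.-1 + k.+1, m.-1))%:R].
    by congr (xget _ _); apply/seteqP; split=> k /=; rewrite !exp1n !mul1n.
  have aE : afun t = xget 0 [set x : R | 0 < x /\
      1%:R `^ x * (1 + x) `^ (1 + x) / x `^ x = t].
    by congr (xget _ _); apply/seteqP; split=> x /=; rewrite powR1 mul1r.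
  rewrite -kE in kN kmax; split; last first.
    exact: (ratio_floor_le _ 1 _ _ _ t isT d0 aE kmax).
  rewrite KE vsE range_tnth; move: (in_tuple vs); rewrite sm -(prednK (ltnW m1)).
  move=> v; apply: Gamma_simplex_image => //.
  by move: kN; rewrite exp1n mul1n.
move=> [c sym] m nm [vs [uvs [sm vsE]]] t.
have m0 : (0 < m)%N by exact: leq_trans nm.
have tE : t ^+ m = (2 ^ n)%:R by apply: powR_div_exprn.
have N0 : (0 < 2 ^ n)%N by rewrite expn_gt0.
have [lN lmax] := weighted_index_spec R 2 _ _ t isT m0 N0 tE.
split; last exact: (ratio_floor_le _ 2 _ _ _ t isT m0 erefl lmax).
have vsP x : x \in vs <-> is_extreme K x.
  by have /seteqP[h1 h2] := vsE; split=> [/h2|/h1].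
have [|||r sr vsr] := involution_transversal _ (fun x => 2%:R *: c - x) vs m uvs sm.
- by move=> x; rewrite subKr.
- by move=> x /vsP/(is_extreme_reflect _ _ _ _ _ sym)/vsP.
(* A vertex fixed by the reflection would be the centre; then every vertex would equal [c], although
   there are 2m >= 2 distinct ones. *)
- move=> x xvs; apply/eqP => xc.
  have cE : x = c.
    apply: (@scalerI _ _ (2 : R)); first by rewrite pnatr_eq0.
    by rewrite -{1}[2 *: x]/(2%:R *: x) scaler_nat mulr2n -{1}xc subrK.
  have cext : is_extreme K c by rewrite -cE; apply/vsP.
  have : {subset vs <= [:: c]}.
    by move=> y /vsP[Ky _]; rewrite inE (extreme_center _ _ _ _ _ sym cext Ky).
  move/(uniq_leq_size uvs); rewrite sm leqNgt => /negP; apply.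
  by rewrite (leq_trans _ (leq_mul (leqnn 2) m0)).
rewrite KE vsE vsr range_tnth; move: (in_tuple r); rewrite sr => v.
(* With one vertex v_i per antipodal pair, the vectors v_i - c serve as half-axes of the
   cross-polytope. *)
rewrite [X in conv X](_ : _ = range (fun p : 'I_m * bool =>
    c + (-1) ^+ p.2 *: (tnth v p.1 - c))).
  exact: (Gamma_cross_image _ _ _ c (fun i => tnth v i - c) _ _ n0 m0 lN).
have flipE x : c + (-1) ^+ true *: (x - c) = 2%:R *: c - x.
  by rewrite expr1 scaleN1r opprB addrA scaler_nat mulr2n.
have idE x : c + (-1) ^+ false *: (x - c) = x.
  by rewrite expr0 scale1r addrC subrK.
apply/seteqP; split=> [x [[i _ <-]|[_ [i _ <-] <-]]|_ [[i []] _ <-]].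
- by exists (i, false) => //=; rewrite idE.
- by exists (i, true) => //=; rewrite flipE.
- by right; exists (tnth v i); [exists i|rewrite flipE].
- by left; exists i => //; rewrite idE.
Qed.
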